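(* Let $Q=Q_1\times\cdots\times Q_n$, let $L^i:TQ_i\to\mathbb{R}$ be Lagrangians, $\Delta_{Q_i}\subset TQ_i$ constraint distributions ($i=1,\dots,n$), and $\Sigma_Q\subset TQ$ an interconnection distribution. Put $L=\sum_{i=1}^n L^i\circ T\pi_{Q_i}$ and $\Delta_Q=(\Delta_{Q_1}\oplus\cdots\oplus\Delta_{Q_n})\cap\Sigma_Q$. Assume that the Lagrangian discretization $\phi:L\mapsto L_d$ is linear and that the constraint discretization is compatible (both in the sense of the context). Then the discretely interconnected equations $$p_{k+1}^i = D_2L_d^i(q_k^i,q_{k+1}^i),$$ $$p_k^i = -D_1L_d^i(q_k^i,q_{k+1}^i)+\sum_{a=1}^{m_i}\mu_{i,a}\,\omega_i^a(q_k^i)+\sum_{b=1}^{l}\lambda_b\,\alpha_i^b(q_k),$$ $$0=\omega_{d+,i}^a(q_k^i,q_{k+1}^i),\quad a=1,\dots,m_i,$$ $$0=\alpha_{d+}^b(q_k,q_{k+1}),\quad b=1,\dots,l,$$ (for $i=1,\dots,n$, with Lagrange multipliers $\mu_{i,a},\lambda_b\in\mathbb{R}$ allowed to depend on $k$) are equivalent to the (+) discrete Dirac equations for $(L,\Delta_Q)$, $$p_{k+1}=D_2L_d(q_k,q_{k+1}),\qquad p_k=-D_1L_d(q_k,q_{k+1})+\sum_c\eta_c\,\beta^c(q_k),\qquad 0=\beta_{d+}^c(q_k,q_{k+1})\ \text{ for all } c,$$ (with multipliers $\eta_c\in\mathbb{R}$ allowed to depend on $k$), where $\{\beta^c\}$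 is the chosen basis of $\Delta_Q^\circ$ described in the context. That is, a sequence $(q_k,p_k)_k$ in $T^*Q$ satisfies the first system for some multipliers if and only if it satisfies the second system for some multipliers.
   Context: Points of $Q=Q_1\times\cdots\times Q_n$ are written $q=(q^1,\dots,q^n)$; $q_k=(q_k^1,\dots,q_k^n)$ is the configuration at the $k$-th time step, and $p_k=(p_k^1,\dots,p_k^n)$ with $p_k^i\in T^*_{q_k^i}Q_i$. $\pi_{Q_i}:Q\to Q_i$ is the projection and $T\pi_{Q_i}$ its tangent map. $D_1,D_2$ denote derivatives with respect to the first and second argument. $\Delta^\circ$ denotes the annihilator of $\Delta$. The intersection defining $\Delta_Q$ is taken fiberwise, and $(\Delta_{Q_1}\oplus\cdots\oplus\Delta_{Q_n})(q)=\prod_i\Delta_{Q_i}(q^i)\subset T_qQ$. Linear Lagrangian discretization: $\phi$ assigns to a Lagrangian on $TQ_i$ (resp. $TQ$) a discrete Lagrangian $L_d^i:Q_i\times Q_i\to\mathbb{R}$ (resp. $L_d:Q\times Q\to\mathbb{R}$), and linearity means that for $L=\sum_i L^i\circ T\pi_{Q_i}$ one gets $L_d(q_k,q_{k+1})=\sum_i L_d^i(q_k^i,q_{k+1}^i)$. Constraint one-forms: $\{\omega_i^a\}_{a=1}^{m_i}$ are one-forms on $Q_i$ forming a basis of $\Delta_{Q_i}^\circ$ at each point. Their extensions to $Q$ are $\tilde\omega_i^a(q)\cdot v_q=\omega_i^a(\pi_{Q_i}(q))\cdot T\pi_{Q_i}(v_q)$. $\{\alpha^b\}_{b=1}^l$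 are one-forms on $Q$ forming a basis of $\Sigma_Q^\circ$ at each point; their components $\alpha_i^b(q)\in T^*_{q^i}Q_i$ are $\alpha_i^b(q)\cdot v=\alpha^b(q)\cdot v^h$, where for $v\in T_{q^i}Q_i$, $v^h=(0,\dots,0,v,0,\dots,0)\in T_qQ$ with $v$ in the $i$-th slot. The chosen basis $\{\beta^c\}$ of $\Delta_Q^\circ$ is the family consisting of all $\tilde\omega_i^a$ ($1\le i\le n$, $1\le a\le m_i$) and all $\alpha^b$ ($1\le b\le l$), which spans $\Delta_Q^\circ$. Constraint discretization: to each one-form $\omega_i^a$ on $Q_i$ is associated a function $\omega_{d+,i}^a:Q_i\times Q_i\to\mathbb{R}$, and to the one-forms $\tilde\omega_i^a,\alpha^b$ on $Q$ functions $\tilde\omega_{d+,i}^a,\alpha_{d+}^b:Q\times Q\to\mathbb{R}$; $\beta_{d+}^c$ denotes the corresponding one of these. (In the standard case a retraction $R$ is used: $\omega_{d+}(q_0,q_1)=\omega(q_0)(R_{q_0}^{-1}(q_1))$, where a retraction on a manifold $M$ is a smooth map $R:TM\to M$ whose restriction $R_q$ to $T_qM$ satisfies $R_q(0_q)=q$ and $T_{0_q}R_q=\mathrm{id}_{T_qM}$; with retractions $R_i$ on $Q_i$ one uses $R_1\times\cdots\times R_n$ on $Q$.) The discretization is called compatible if $\tilde\omega_{d+,i}^a(q_k,q_{k+1})=\omega_{d+,i}^a(q_k^i,q_{k+1}^i)$ for all $i,a$. *)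

(* Defs.v *)
(* Finite-dimensional smooth manifolds over an arbitrary R : realType, their
   finite products, and (+) discrete Dirac mechanics on them
   (MathComp-Analysis). *)
From HB Require Import structures.
From mathcomp Require Import all_boot all_order all_algebra.
From mathcomp Require Import all_classical all_reals all_analysis.

Set Implicit Arguments.
Unset Strict Implicit.
Unset Printing Implicit Defensive.

Import Order.TTheory GRing.Theory Num.Theory.
Import numFieldNormedType.Exports.

Local Open Scope classical_set_scope.
Local Open Scope ring_scope.

Section Smooth.
Context {R : realType}.

(* C^k on an open set U; only the values of f on U matter. *)
Fixpoint Ck {V W : normedModType R} (k : nat) (U : set V) (f : V -> W) : Prop :=
  if k is k'.+1 then
    (forall x, U x -> differentiable f x) /\
    (forall v, Ck k' U (fun x => 'd f x v))
  else forall x, U x -> {for x, continuous f}.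

Definition smooth_on {V W : normedModType R} (U : set V) (f : V -> W) : Prop :=
  forall k, Ck k U f.

Lemma near0_diff {V W : normedModType R} (h : V -> W) x :
  (\near x, h x = 0) -> is_diff x h 0.
Proof.
move=> h0; have hx : h x = 0 by exact: nbhs_singleton h0.
have H : h \o shift x = cst (h x) + (\0 : {linear V -> W}) +o_ 0 id.
  apply/eqaddoP => e e0; rewrite (near_shift 0 x) /= in h0.
  near=> y; have hy : h (y + x) = 0.
    have : h (y + (x - 0)) = 0 by near: y.
    by rewrite subr0.
  have -> : (h \o shift x - (cst (h x) + (\0 : V -> W))) y = 0.
    by rewrite hx !fctE /= hy addr0 subr0.
  by rewrite normr0 mulr_ge0 // ltW.
have c : continuous (\0 : {linear V -> W}) by move=> y; exact: cst_continuous.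
have d0 := diff_unique c H.
apply: DiffDef; last by rewrite d0.
by apply/diff_locallyP; rewrite d0.
Unshelve. all: by end_near. Qed.

Lemma near_eq_diff {V W : normedModType R} (f g : V -> W) x :
  (\near x, f x = g x) -> differentiable f x ->
  differentiable g x /\ 'd g x = 'd f x :> (V -> W).
Proof.
move=> fg df.
have /near0_diff h0 : \near x, (g - f) x = 0.
  by near=> y; rewrite !fctE; apply/eqP; rewrite subr_eq0 eq_sym; apply/eqP; near: y.
have H : is_diff x (f + (g - f)) (('d f x : V -> W) + 0).
  by apply: is_diffD; exact: differentiableP.
have -> : g = f + (g - f) by rewrite addrC subrK.
by split; [exact: ex_diff | rewrite diff_val addr0].
Unshelve. all: by end_near. Qed.

Lemma Ck_eq {V W : normedModType R} k (U : set V) (f g : V -> W) : open U ->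
  (forall x, U x -> f x = g x) -> Ck k U f -> Ck k U g.
Proof.
move=> oU; elim: k f g => [|k IH] f g fg.
  move=> cf x Ux; have := cf x Ux; rewrite /prop_for /continuous_at -fg //.
  apply: cvg_trans; apply: near_eq_cvg.
  by near=> y; apply: fg; near: y; exact: open_nbhs_nbhs.
have nfg x : U x -> \near x, f x = g x.
  by move=> Ux; near=> y; apply: fg; near: y; exact: open_nbhs_nbhs.
case=> df ddf; split=> [x Ux|v].
  by have [] := near_eq_diff (nfg x Ux) (df x Ux).
apply: IH (ddf v) => x Ux.
by have [_ ->] := near_eq_diff (nfg x Ux) (df x Ux).
Unshelve. all: by end_near. Qed.

Lemma CkD {V W : normedModType R} k (U : set V) (f g : V -> W) : open U ->
  Ck k U f -> Ck k U g -> Ck k U (f + g).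
Proof.
move=> oU; elim: k f g => [|k IH] f g.
  by move=> cf cg x Ux; apply: continuousD; [exact: cf | exact: cg].
move=> [df ddf] [dg ddg]; split=> [x Ux|v].
  by apply: differentiableD; [exact: df | exact: dg].
apply: Ck_eq oU _ (IH _ _ (ddf v) (ddg v)) => x Ux.
by rewrite diffD; [ | exact: df | exact: dg].
Qed.

Lemma Ck0 {V W : normedModType R} k (U : set V) : Ck k U (0 : V -> W).
Proof.
elim: k => [|k IH]; first by move=> x _; exact: cst_continuous.
split=> [x _|v]; first exact: differentiable_cst.
suff -> : (fun x : V => 'd (0 : V -> W) x v) = 0 by [].
by apply/funext => x; exact: (congr1 (@^~ v) (@diff_cst _ V W 0 x)).
Qed.

Lemma Ck_sum {V W : normedModType R} k (U : set V) n (f : 'I_n -> V -> W) :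
  open U -> (forall i, Ck k U (f i)) -> Ck k U (\sum_i f i).
Proof.
move=> oU Hf; elim/big_ind : _ => //; first exact: Ck0.
by move=> g h; exact: CkD.
Qed.

Lemma Ck_lin {V V' W W' : normedModType R} k (U : set V) (U' : set V')
    (P : {linear V' -> V}) (J : {linear W -> W'}) (f : V -> W) :
  open U' -> continuous P -> continuous J -> (forall x, U' x -> U (P x)) ->
  Ck k U f -> Ck k U' (J \o f \o P).
Proof.
move=> oU' cP cJ PU; elim: k f => [|k IH] f.
  move=> cf x /PU Ux; apply: continuous_comp; first exact: cP.
  by apply: continuous_comp; [exact: cf | exact: cJ].
move=> [df ddf].
have dP x : differentiable P x by exact: linear_differentiable.
have dJ x : differentiable J x by exact: linear_differentiable.
split=> [x /PU Ux|v].
  apply: differentiable_comp => //; apply: differentiable_comp => //.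
  exact: df.
apply: Ck_eq oU' _ (IH _ (ddf (P v))) => x /PU Ux /=.
have dfx := df _ Ux; have dJf := differentiable_comp dfx (dJ (f (P x))).
have -> := diff_comp (dP x) dJf; have -> := diff_comp dfx (dJ (f (P x))).
by rewrite /= (diff_lin _ cP) (diff_lin _ cJ).
Qed.

End Smooth.

Section Blocks.
Context {R : realType} (n : nat) (d : 'I_n -> nat).

Definition block_out (i : 'I_n) (y : 'rV[R]_(\sum_j d j)) : 'rV[R]_(d i) :=
  submxrow y i.

(* (0, ..., 0, v, 0, ..., 0) with v in the i-th slot *)
Definition block_in (i : 'I_n) (v : 'rV[R]_(d i)) : 'rV[R]_(\sum_j d j) :=
  \mxrow_j dfwith (fun j => 0 : 'rV[R]_(d j)) i v j.

Lemma block_outE y i : block_out i y = submxrow y i. Proof. by []. Qed.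

Lemma block_out_in i j v :
  block_out j (block_in v) = dfwith (fun j => 0 : 'rV[R]_(d j)) i v j.
Proof. by rewrite /block_out mxrowK. Qed.

Fact block_out_linear i : linear (@block_out i).
Proof. by move=> a u v; apply/matrixP => s t; rewrite !mxE. Qed.

HB.instance Definition _ i := GRing.isLinear.Build R
  'rV[R]_(\sum_j d j) 'rV[R]_(d i) _ (@block_out i) (@block_out_linear i).

Fact block_in_linear i : linear (@block_in i).
Proof.
move=> a u v; apply/mxrowP => j; rewrite -!block_outE.
rewrite linearP /= !block_out_in.
have [<-|ij] := eqVneq i j; first by rewrite !dfwithin.
by rewrite !dfwithout // scaler0 addr0.
Qed.

HB.instance Definition _ i := GRing.isLinear.Build R
  'rV[R]_(d i) 'rV[R]_(\sum_j d j) _ (@block_in i) (@block_in_linear i).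

Lemma mxrow_block_in (f : forall i, 'rV[R]_(d i)) :
  \mxrow_i f i = \sum_i block_in (f i).
Proof.
apply/mxrowP => j; rewrite mxrowK submxrow_sum (bigD1 j) //=.
rewrite -block_outE block_out_in dfwithin big1 ?addr0 // => i ij.
by rewrite -block_outE block_out_in dfwithout.
Qed.

Lemma cvg_rV (T : Type) (F : set_system T) (FF : Filter F) m
    (f : T -> 'rV[R]_m) (l : 'rV[R]_m) :
  (forall j, (fun x => f x ord0 j) @ F --> l ord0 j) -> f @ F --> l.
Proof.
move=> H A [P lP PA]; apply: filterS; first exact: PA.
have : \forall x \near F, forall j, P ord0 j (f x ord0 j).
  by apply: filter_forall => j; apply: (H j); exact: lP.
by apply: filterS => x Px i j; rewrite ord1.
Qed.

Lemma block_out_continuous i : continuous (@block_out i).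
Proof.
move=> y; apply: (@cvg_rV _ (nbhs y)) => j; rewrite mxE.
have -> : (fun x => block_out i x ord0 j) = (fun x => x ord0 (tagnat.Rank i j)).
  by apply/funext => x; rewrite mxE.
exact: coord_continuous.
Qed.

Lemma block_in_continuous i : continuous (@block_in i).
Proof.
move=> v; apply: (@cvg_rV _ (nbhs v)) => j; rewrite mxE.
have -> : (fun x => block_in x ord0 j) =
    (fun x => dfwith (fun j => 0 : 'rV[R]_(d j)) i x (tagnat.sig1 j)
                ord0 (tagnat.sig2 j)).
  by apply/funext => x; rewrite mxE.
move: (tagnat.sig1 j) (tagnat.sig2 j) => k.
have [<-|ik] := eqVneq i k => b.
  rewrite dfwithin; under eq_fun do rewrite dfwithin.
  exact: coord_continuous.
rewrite dfwithout //; under eq_fun do rewrite dfwithout //.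
exact: cvg_cst.
Qed.

End Blocks.

Section Manifold.
Context {R : realType}.

Record chart (T : topologicalType) (d : nat) := Chart {
  cdom : set T ;
  ccod : set 'rV[R]_d ;
  cfun : T -> 'rV[R]_d ;
  cinv : 'rV[R]_d -> T ;
  cdom_open : open cdom ;
  ccod_open : open ccod ;
  cfun_cod : forall x, cdom x -> ccod (cfun x) ;
  cinv_dom : forall y, ccod y -> cdom (cinv y) ;
  cfunK : forall x, cdom x -> cinv (cfun x) = x ;
  cinvK : forall y, ccod y -> cfun (cinv y) = y ;
  cfun_continuous : forall x, cdom x -> {for x, continuous cfun} ;
  cinv_continuous : forall y, ccod y -> {for y, continuous cinv} }.

Definition transition_dom (T : topologicalType) d (c c' : chart T d) :=
  ccod c `&` [set y | cdom c' (cinv c y)].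

Definition transition (T : topologicalType) d (c c' : chart T d) :=
  cfun c' \o cinv c.

(* Each point carries a preferred chart of the atlas; tangent and cotangent
   vectors at that point are represented by their coordinates in it. *)
Record manifold := Manifold {
  mspace :> topologicalType ;
  mdim : nat ;
  matlas : set (chart mspace mdim) ;
  chart_at : mspace -> chart mspace mdim ;
  chart_at_atlas : forall x, matlas (chart_at x) ;
  chart_at_dom : forall x, cdom (chart_at x) x ;
  transition_smooth : forall c c', matlas c -> matlas c' ->
    smooth_on (transition_dom c c') (transition c c') ;
  manifold_hausdorff : hausdorff_space mspace ;
  manifold_second_countable : @second_countable mspace }.

End Manifold.
Arguments manifold : clear implicits.
Arguments chart : clear implicits.
Arguments cdom_open {R T d} c.
Arguments ccod_open {R T d} c.

Lemma transition_dom_open {R : realType} (T : topologicalType) d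
  (c c' : chart R T d) : open (transition_dom c c').
Proof.
rewrite openE => y [cy cy']; apply: filterI.
  by apply: open_nbhs_nbhs; split=> //; exact: ccod_open.
by apply: (cinv_continuous cy); apply: open_nbhs_nbhs; split=> //; exact: cdom_open.
Qed.
Arguments transition_dom_open {R T d} c c'.

Section Product.
Context {R : realType} (n : nat) (Q : 'I_n -> manifold R).

Local Notation QT := (prod_topology (fun i => mspace (Q i))).
Local Notation d := (fun i => mdim (Q i)).
Local Notation D := (\sum_i mdim (Q i))%N.

Lemma prod_cvg (T : Type) (F : set_system T) (FF : Filter F) (f : T -> QT)
    (l : QT) : (forall i, (fun x => f x i) @ F --> l i) -> f @ F --> l.
Proof.
move=> H; apply/cvg_sup => i A [_ [[B oB <-] /= Bl] BA].
by apply: filterS BA _; apply: (H i); exact: open_nbhs_nbhs.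
Qed.

Lemma prod_projc i : continuous (fun q : QT => q i).
Proof. exact: (@proj_continuous _ (fun i => mspace (Q i)) i). Qed.

Section ProductChart.
Variable c : forall i, chart R (Q i) (mdim (Q i)).

Definition pc_dom : set QT := [set q | forall i, cdom (c i) (q i)].
Definition pc_cod : set 'rV[R]_D := [set y | forall i, ccod (c i) (block_out i y)].
Definition pc_fun (q : QT) : 'rV[R]_D := \mxrow_i cfun (c i) (q i).
Definition pc_inv (y : 'rV[R]_D) : QT := fun i => cinv (c i) (block_out i y).

Lemma pc_dom_open : open pc_dom.
Proof.
rewrite openE => q cq; apply: (@filter_forall _ _ _ _ (nbhs_filter q)) => i.
apply: (@prod_projc i q); apply: open_nbhs_nbhs; split=> //; exact: cdom_open.
Qed.

Lemma pc_cod_open : open pc_cod.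
Proof.
rewrite openE => y cy; apply: (@filter_forall _ _ _ _ (nbhs_filter y)) => i.
apply: (@block_out_continuous R n d i y); apply: open_nbhs_nbhs.
by split; [exact: ccod_open | exact: cy].
Qed.

Lemma pc_fun_cod q : pc_dom q -> pc_cod (pc_fun q).
Proof. by move=> cq i; rewrite block_outE mxrowK; apply: cfun_cod. Qed.

Lemma pc_inv_dom y : pc_cod y -> pc_dom (pc_inv y).
Proof. by move=> cy i; apply: cinv_dom; exact: cy. Qed.

Lemma pc_funK q : pc_dom q -> pc_inv (pc_fun q) = q.
Proof.
move=> cq; apply/functional_extensionality_dep => i.
by rewrite /pc_inv block_outE mxrowK cfunK.
Qed.

Lemma pc_invK y : pc_cod y -> pc_fun (pc_inv y) = y.
Proof.
move=> cy; apply/mxrowP => i; rewrite mxrowK cinvK //; exact: cy.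
Qed.

Lemma pc_fun_continuous q : pc_dom q -> {for q, continuous pc_fun}.
Proof.
move=> cq; apply: (@cvg_rV R _ (nbhs q)) => j; rewrite mxE.
set k := tagnat.sig1 j; set b := tagnat.sig2 j.
have -> : (fun x => pc_fun x ord0 j) = (fun x => cfun (c k) (x k) ord0 b).
  by apply/funext => x; rewrite mxE.
have H : {for q, continuous (cfun (c k) \o (fun x : QT => x k))}.
  by apply: continuous_comp; [exact: prod_projc | exact: cfun_continuous].
have := continuous_comp H (@coord_continuous _ _ _ ord0 b _).
exact.
Qed.

Lemma pc_inv_continuous y : pc_cod y -> {for y, continuous pc_inv}.
Proof.
move=> cy; apply: (@prod_cvg _ (nbhs y)) => i.
have := continuous_comp (@block_out_continuous R n d i y)
  (cinv_continuous (cy i)).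
exact.
Qed.

Definition prod_chart : chart R QT D := Chart pc_dom_open pc_cod_open pc_fun_cod
  pc_inv_dom pc_funK pc_invK pc_fun_continuous pc_inv_continuous.

End ProductChart.

Definition prod_atlas : set (chart R QT D) :=
  [set C | exists2 c : forall i, chart R (Q i) (mdim (Q i)),
             (forall i, matlas (c i)) & C = prod_chart c].

Definition prod_chart_at (q : QT) : chart R QT D :=
  prod_chart (fun i => chart_at (q i)).

Lemma prod_chart_at_atlas q : prod_atlas (prod_chart_at q).
Proof. by exists (fun i => chart_at (q i)) => // i; exact: chart_at_atlas. Qed.

Lemma prod_chart_at_dom q : cdom (prod_chart_at q) q.
Proof. by move=> i; exact: chart_at_dom. Qed.

Lemma prod_transition_smooth C C' : prod_atlas C -> prod_atlas C' ->
  smooth_on (transition_dom C C') (transition C C').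
Proof.
move=> [c ac ->] [c' ac' ->] k.
have oU := transition_dom_open (prod_chart c) (prod_chart c').
apply: (@Ck_eq _ _ _ _ _
  (\sum_i (@block_in R n d i \o transition (c i) (c' i) \o @block_out R n d i))).
- exact: oU.
- move=> y _; rewrite /transition /= /pc_fun mxrow_block_in.
  by rewrite fct_sumE.
- apply: Ck_sum => // i.
  apply: (@Ck_lin _ _ _ _ _ _ (transition_dom (c i) (c' i)) _
    (@block_out R n d i) (@block_in R n d i)) => //.
  + exact: block_out_continuous.
  + exact: block_in_continuous.
  + by move=> y [cy cy']; split; [exact: cy | exact: cy'].
  + exact: transition_smooth.
Qed.

Lemma prod_hausdorff : hausdorff_space QT.
Proof.
apply: (@hausdorff_product _ (fun i => mspace (Q i))) => i.
exact: manifold_hausdorff.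
Qed.

Lemma prod_second_countable : @second_countable QT.
Proof.
have B_ i : {B : set (set (Q i)) | countable B /\ basis B}.
  by apply/cid; have [B] := manifold_second_countable (Q i); exists B.
pose B i := sval (B_ i).
have cB i : countable (B i) by have [] := svalP (B_ i).
have bB i : basis (B i) by have [] := svalP (B_ i).
pose F := [set S : forall i, set (Q i) | forall i, B i (S i)].
pose cyl (S : forall i, set (Q i)) : set QT := [set q | forall i, S i (q i)].
exists (cyl @` F).
  apply: (@sub_countable _ _ _ F); first exact: card_image_le.
  have h_ i : {h : set (Q i) -> nat | set_inj (B i) h}.
    by apply/cid; have /countable_injP[h hi] := cB i; exists h.
  apply/countable_injP.
  exists (fun S => pickle [ffun i => sval (h_ i) (S i)]).
  move=> S S' /set_mem FS /set_mem FS' /(pcan_inj pickleK) /ffunP E.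
  apply/functional_extensionality_dep => i.
  have := E i; rewrite !ffunE; by apply: (svalP (h_ i)); apply/mem_set.
split.
  move=> _ [S FS <-]; rewrite openE => q Sq.
  apply: (@filter_forall _ _ _ _ (nbhs_filter q)) => i.
  apply: (@prod_projc i q); apply: open_nbhs_nbhs; split=> //.
  by have [sub _] := bB i; apply: sub; exact: FS.
move=> q.
have pick (A : forall i, set (Q i)) : (forall i, nbhs (q i) (A i)) ->
    exists2 S, F S & cyl S q /\ forall i, S i `<=` A i.
  move=> qA.
  have S_ i : {s : set (Q i) | [/\ B i s, s (q i) & s `<=` A i]}.
    apply/cid; have [_ /(_ (q i) _ (qA i)) [s [Bs sq] sA]] := bB i.
    by exists s.
  exists (fun i => sval (S_ i)) => [i|]; first by have [] := svalP (S_ i).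
  by split=> i; have [] := svalP (S_ i).
set G := filter_from _ _.
have FG : Filter G.
  apply: filter_from_filter.
    have [S FS [Sq _]] := pick (fun=> setT) (fun=> filterT).
    by exists (cyl S); split=> //; exists S.
  move=> _ _ [[S FS <-] Sq] [[S' FS' <-] Sq'].
  have nS i : nbhs (q i) (S i `&` S' i).
    apply: filterI; apply: open_nbhs_nbhs; split=> //; have [sub _] := bB i;
      by apply: sub.
  have [T FT [Tq TS]] := pick _ nS.
  exists (cyl T); first by split=> //; exists T.
  by move=> x Tx; split=> i; have [] := TS i _ (Tx i).
apply: (@prod_cvg _ G FG id q) => i A qA.
have nA j : nbhs (q j) (dfwith (fun j => [set: Q j]) i A j).
  by case: dfwithP => // j' _; exact: filterT.
have [T FT [Tq TA]] := pick _ nA.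
exists (cyl T); first by split=> //; exists T.
by move=> x Tx /=; have := TA i _ (Tx i); rewrite dfwithin.
Qed.

(* The preferred chart at q is the product of the preferred charts at the q i,
   so the i-th block of a tangent vector at q is its component at q i. *)
Definition prod_manifold : manifold R :=
  @Manifold R QT D prod_atlas prod_chart_at prod_chart_at_atlas
    prod_chart_at_dom prod_transition_smooth prod_hausdorff
    prod_second_countable.

End Product.

Section TangentSpaces.
Context {R : realType}.

Definition tangent (M : manifold R) (x : M) : vectType R := 'rV[R]_(mdim M).
Definition cotangent (M : manifold R) (x : M) : vectType R := 'Hom(tangent x, R^o).

Definition tangent_map (M N : manifold R) (f : M -> N) (x : M) :
    'Hom(tangent x, tangent (f x)) :=
  linfun ('d (cfun (chart_at (f x)) \o f \o cinv (chart_at x))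
             (cfun (chart_at x) x)).

Definition mdiff (M : manifold R) (f : M -> R) (x : M) : cotangent x :=
  linfun ('d (f \o cinv (chart_at x) : 'rV[R]_(mdim M) -> R^o)
             (cfun (chart_at x) x)).

(* The tangent vector at x whose coordinates in the chart c are v. *)
Definition of_coord (M : manifold R) (c : chart R M (mdim M)) (x : M)
    (v : 'rV[R]_(mdim M)) : tangent x :=
  'd (transition c (chart_at x)) (cfun c x) v.

Definition oneform (M : manifold R) : Type := forall x : M, cotangent x.

Definition smooth_oneform (M : manifold R) (w : oneform M) : Prop :=
  forall c, matlas c -> forall v : 'rV[R]_(mdim M),
    smooth_on (ccod c)
      (fun y => w (cinv c y) (of_coord c (cinv c y) v) : R^o).

Definition pullback (M N : manifold R) (f : M -> N) (w : oneform N) : oneform M :=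
  fun x => (w (f x) \o tangent_map f x)%VF.

(* A field of subspaces, of possibly varying rank (the intersection of two
   subbundles need not be one).  Regularity is expressed through the
   annihilator: if it has a basis of globally defined smooth one-forms, the
   distribution is a smooth subbundle. *)
Definition tangent_distribution (M : manifold R) : Type :=
  forall x : M, {vspace tangent x}.

Definition annihilator (V : vectType R) (U : {vspace V}) : set 'Hom(V, R^o) :=
  [set f | forall u, u \in U -> f u = 0].

Definition spans_annihilator (M : manifold R) (I : finType)
    (w : I -> oneform M) (D : tangent_distribution M) : Prop :=
  forall x, [set` <<[seq w a x | a : I]>>%VS] = annihilator (D x).

Definition annihilator_basis (M : manifold R) (I : finType)
    (w : I -> oneform M) (D : tangent_distribution M) : Prop :=
  spans_annihilator w D /\ forall x, free [seq w a x | a : I].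

End TangentSpaces.

Section Lagrangians.
Context {R : realType}.

Definition lagrangian (M : manifold R) : Type := forall x : M, tangent x -> R.

(* Smoothness on TM, in the charts of TM induced by those of M. *)
Definition smooth_lagrangian (M : manifold R) (L : lagrangian M) : Prop :=
  forall c, matlas c ->
    smooth_on [set w : 'rV[R]_(mdim M + mdim M) | ccod c (lsubmx w)]
      (fun w => L (cinv c (lsubmx w))
                  (of_coord c (cinv c (lsubmx w)) (rsubmx w)) : R^o).

(* Smoothness on M x M, in product charts. *)
Definition smooth_pair (M : manifold R) (f : M -> M -> R) : Prop :=
  forall c c', matlas c -> matlas c' ->
    smooth_on [set w : 'rV[R]_(mdim M + mdim M) |
                ccod c (lsubmx w) /\ ccod c' (rsubmx w)]
      (fun w => f (cinv c (lsubmx w)) (cinv c' (rsubmx w)) : R^o).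

Record lagrangian_discretization (M : manifold R) := LagrangianDiscretization {
  discretize :> lagrangian M -> M -> M -> R ;
  discretize_smooth : forall L, smooth_lagrangian L -> smooth_pair (discretize L) }.

Definition D1 (M : manifold R) (f : M -> M -> R) (x y : M) : cotangent x :=
  mdiff (f ^~ y) x.
Definition D2 (M : manifold R) (f : M -> M -> R) (x y : M) : cotangent y :=
  mdiff (f x) y.

End Lagrangians.

Section Interconnection.
Context {R : realType} (n : nat) (Q : 'I_n -> manifold R).

Local Notation QQ := (prod_manifold Q).

Definition mproj (i : 'I_n) (q : QQ) : Q i := q i.

Definition horizontal (q : QQ) (i : 'I_n) : 'Hom(tangent (q i), tangent q) :=
  linfun (@block_in R n (fun j => mdim (Q j)) i).

Definition component (q : QQ) (p : cotangent q) (i : 'I_n) : cotangent (q i) :=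
  (p \o horizontal q i)%VF.

Definition sum_lagrangian (L : forall i, lagrangian (Q i)) : lagrangian QQ :=
  fun q v => \sum_i L i (q i) (tangent_map (mproj i) q v).

Definition prod_distribution (D : forall i, tangent_distribution (Q i)) :
    tangent_distribution QQ :=
  fun q => (\bigcap_i (tangent_map (mproj i) q @^-1: D i (q i)))%VS.

Definition interconnected_distribution
    (D : forall i, tangent_distribution (Q i))
    (S : tangent_distribution QQ) : tangent_distribution QQ :=
  fun q => (prod_distribution D q :&: S q)%VS.

(* Additivity over the factors: the discrete Lagrangian of
   \sum_i L i \o T(mproj i) is the sum of the discrete Lagrangians of the L i. *)
Definition linear_discretization
    (phi : forall i, lagrangian_discretization (Q i))
    (phiQ : lagrangian_discretization QQ) : Prop :=
  forall L : forall i, lagrangian (Q i), (forall i, smooth_lagrangian (L i)) ->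
  forall q q' : QQ,
    phiQ (sum_lagrangian L) q q' = \sum_i phi i (L i) (q i) (q' i).

Definition constraint_index (m : 'I_n -> nat) (l : nat) : finType :=
  ({i : 'I_n & 'I_(m i)} + 'I_l)%type.

Definition constraint_forms (m : 'I_n -> nat) (l : nat)
    (w : forall i, 'I_(m i) -> oneform (Q i)) (alpha : 'I_l -> oneform QQ)
    (c : constraint_index m l) : oneform QQ :=
  match c with
  | inl ia => pullback (mproj (tag ia)) (w (tag ia) (tagged ia))
  | inr b => alpha b
  end.

Definition constraint_functions (m : 'I_n -> nat) (l : nat)
    (wtd : forall i, 'I_(m i) -> QQ -> QQ -> R) (alphad : 'I_l -> QQ -> QQ -> R)
    (c : constraint_index m l) : QQ -> QQ -> R :=
  match c with
  | inl ia => wtd (tag ia) (tagged ia)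
  | inr b => alphad b
  end.

Definition compatible_discretization (m : 'I_n -> nat)
    (wd : forall i, 'I_(m i) -> Q i -> Q i -> R)
    (wtd : forall i, 'I_(m i) -> QQ -> QQ -> R) : Prop :=
  forall i a (q q' : QQ), wtd i a q q' = wd i a (q i) (q' i).

(* K is the set of time steps at which the equations are imposed: setT for an
   infinite trajectory, `I_N for one with time steps 0, ..., N. *)
Definition interconnected_equations (K : set nat)
    (Ld : forall i, Q i -> Q i -> R)
    (m : 'I_n -> nat) (w : forall i, 'I_(m i) -> oneform (Q i))
    (wd : forall i, 'I_(m i) -> Q i -> Q i -> R)
    (l : nat) (alpha : 'I_l -> oneform QQ) (alphad : 'I_l -> QQ -> QQ -> R)
    (q : nat -> QQ) (p : forall k, cotangent (q k))
    (mu : nat -> forall i, 'I_(m i) -> R) (lambda : nat -> 'I_l -> R) : Prop :=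
  forall k, K k ->
    (forall i,
      [/\ component (p k.+1) i = D2 (Ld i) (q k i) (q k.+1 i),
          component (p k) i = - D1 (Ld i) (q k i) (q k.+1 i)
            + \sum_a mu k i a *: w i a (q k i)
            + \sum_b lambda k b *: component (alpha b (q k)) i
        & forall a, 0 = wd i a (q k i) (q k.+1 i)]) /\
    (forall b, 0 = alphad b (q k) (q k.+1)).

End Interconnection.

Definition discrete_dirac_equations {R : realType} (M : manifold R) (K : set nat)
    (Ld : M -> M -> R) (I : finType) (beta : I -> oneform M)
    (betad : I -> M -> M -> R)
    (q : nat -> M) (p : forall k, cotangent (q k)) (eta : nat -> I -> R) : Prop :=
  forall k, K k ->
    [/\ p k.+1 = D2 Ld (q k) (q k.+1),
        p k = - D1 Ld (q k) (q k.+1) + \sum_c eta k c *: beta c (q k)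
      & forall c, 0 = betad c (q k) (q k.+1)].

(* Main.v *)
Require Import Defs.
From HB Require Import structures.
From mathcomp Require Import all_boot all_order all_algebra.
From mathcomp Require Import all_classical all_reals all_analysis.

Set Implicit Arguments.
Unset Strict Implicit.
Unset Printing Implicit Defensive.

Import Order.TTheory GRing.Theory Num.Theory.
Import numFieldNormedType.Exports.

Local Open Scope classical_set_scope.
Local Open Scope ring_scope.

(** A covector on the product is determined by its components on the factors,
    so the whole theorem is a comparison of components.

    Discrete Lagrangian: by linearity it is a sum of functions of the separate
    pairs (q_k^i, q_{k+1}^i), and the differential of a sum of functions of
    separate variables has the differentials of the summands as components
    ([component_mdiff_sum], used as [component_D1_sum] and
    [component_D2_sum]).  Differentiability of each summand comes from
    the smoothness of discretizations of smooth Lagrangians.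

    Constraint forces: the i-th component of the lift of a one-form on the
    j-th factor is that form if i = j and zero otherwise
    ([component_pullback_id], [component_pullback_neq]).  Hence a combination
    of the forms beta^c with multipliers eta has i-th component
    sum_a mu_{i,a} omega_i^a + sum_b lambda_b alpha_i^b, where mu and lambda
    are the two parts of eta ([component_constraint_sum]); splitting and
    joining families of multipliers are mutually inverse, which turns one
    system into the other ([interconnected_dirac]).  The constraint equations
    themselves correspond one by one, by compatibility.

    Spanning of the annihilator: in finite dimension, a family of forms spans
    the annihilator of a subspace exactly when that subspace is the common
    kernel of the family ([spans_annihilatorP]).  In this form the claim about
    the interconnected distribution is immediate, since a common kernel of a
    union of families is an intersection of common kernels
    ([interconnected_spans]). *)

(** * Linear forms and annihilators *)

Section Forms.
Context {K : fieldType} {V : vectType K}.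

Lemma span_vanish (I : finType) (s : I -> 'Hom(V, K^o)) f v :
  f \in <<[seq s a | a : I]>>%VS -> (forall a, s a v = 0) -> f v = 0.
Proof.
rewrite span_def big_image => /memv_sumP[g gs ->] sv.
rewrite sum_lfunE big1 // => a _.
by have /vlineP[k ->] := gs a isT; rewrite lfunE /= sv scaler0.
Qed.

(** Let [g] be the linear map with coordinates [s a].  Since [f] vanishes on the
    kernel of [g], it factors as a linear form composed with [g], and a linear
    form of the coordinates of [g] is a combination of the [s a]. *)
Lemma span_of_vanish (I : finType) (s : I -> 'Hom(V, K^o)) (f : 'Hom(V, K^o)) :
  (forall v, (forall a, s a v = 0) -> f v = 0) ->
  f \in <<[seq s a | a : I]>>%VS.
Proof.
move=> fs.
pose ev v : {ffun I -> K^o} := [ffun a => s a v].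
have ev_lin : linear ev.
  by move=> k u v; apply/ffunP => a; rewrite !ffunE linearP.
pose evL := GRing.isLinear.Build K V {ffun I -> K^o} *:%R ev ev_lin.
pose evl : {linear V -> {ffun I -> K^o}} := HB.pack ev evL.
pose g := linfun evl.
have gE v a : g v a = s a v by rewrite lfunE /= ffunE.
(* g^-1 is a section of g over the image of g, where g v lies. *)
pose h := (f \o g^-1)%VF.
have fh v : f v = h (g v).
  apply/eqP; rewrite lfunE /= -subr_eq0 -linearB; apply/eqP/fs => a.
  by rewrite -gE linearB /= limg_lfunVK ?memv_img ?memvf // subrr ffunE.
pose e a : {ffun I -> K^o} := [ffun b => (b == a)%:R].
have -> : f = \sum_a h (e a) *: s a.
  apply/lfunP => v; rewrite fh sum_lfunE.
  have -> : g v = \sum_a s a v *: e a.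
    apply/ffunP => b; rewrite gE sum_ffunE (bigD1 b) //= !ffunE eqxx.
    rewrite big1 ?addr0 => [|a ab]; first by rewrite /GRing.scale /= mulr1.
    by rewrite !ffunE eq_sym (negPf ab) scaler0.
  rewrite linear_sum; apply: eq_bigr => a _.
  by rewrite linearZ [RHS]lfunE /= /GRing.scale /= mulrC.
apply: memv_suml => a _; apply/memvZ/memv_span.
exact: (fintype.image_f s).
Qed.

(** The double annihilator of a subspace is the subspace: the coordinates of
    [u - projv U u] are values at [u] of forms that vanish on [U]. *)
Lemma mem_of_annihilated (U : {vspace V}) u :
  (forall f : 'Hom(V, K^o), (forall v, v \in U -> f v = 0) -> f u = 0) ->
  u \in U.
Proof.
move=> Uu; suff -> : u = projv U u by exact: memv_proj.
apply/eqP; rewrite -subr_eq0; apply/eqP.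
rewrite (coord_vbasis (memvf (u - projv U u))) big1 // => i _.
pose c : 'Hom(V, K^o) := linfun (coord (vbasis {:V}) i : V -> K^o).
have := Uu (c \o (\1 - projv U))%VF.
rewrite lfunE /= !lfunE /= !lfunE /= => -> //; first by rewrite scale0r.
by move=> v vU; rewrite lfunE /= !lfunE /= !lfunE /= projv_id // subrr linear0.
Qed.

End Forms.

Section Annihilators.
Context {R : realType} {M : manifold R} {I : finType}.

(** Intersections and preimages of subspaces are given by conditions on vectors,
    so the spanning conditions on the factors and on the interconnection combine
    directly in this dual form. *)
Lemma spans_annihilatorP (w : I -> oneform M) (D : tangent_distribution M) :
  spans_annihilator w D <->
  forall x (v : tangent x), v \in D x <-> forall a, w a x v = 0.
Proof.
split=> [wD x v|Dw x].
  split=> [vD a|wv].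
    suff : annihilator (D x) (w a x) by exact.
    by rewrite -wD; apply: memv_span; exact: (fintype.image_f (w^~ x)).
  apply: mem_of_annihilated => f fD; apply: (span_vanish _ wv).
  by have : annihilator (D x) f by []; rewrite -wD.
apply/seteqP; split=> f /= fH.
  by move=> v /Dw; exact: span_vanish.
by apply: span_of_vanish => v /Dw; exact: fH.
Qed.

End Annihilators.

(** * Calculus in coordinates *)

Lemma is_diff_sum {R : realType} {V W : normedModType R} (I : finType)
    (f df : I -> V -> W) (x : V) :
  (forall i, is_diff x (f i) (df i)) -> is_diff x (\sum_i f i) (\sum_i df i).
Proof.
move=> dfi.
(* The cases of 0 and + are instances of the class is_diff. *)
by apply: (big_ind2 (is_diff x)).
Qed.

Section RowVectors.
Context {R : realType}.

Lemma mulmxr_continuous m k (A : 'M[R]_(m, k)) :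
  continuous (mulmxr A : 'rV[R]_m -> 'rV[R]_k).
Proof.
move=> x; apply: (@cvg_rV R _ (nbhs x)) => j.
under eq_fun do rewrite /= mxE.
rewrite /= mxE; apply: cvg_big => [|i _]; first exact: add_continuous.
by apply: cvgMr_tmp; exact: coord_continuous.
Qed.

Lemma differentiable_row_mx (V : normedModType R) m k
    (f : V -> 'rV[R]_m) (g : V -> 'rV[R]_k) (x : V) :
  differentiable f x -> differentiable g x ->
  differentiable (fun y => row_mx (f y) (g y)) x.
Proof.
move=> df dg; have -> : (fun y => row_mx (f y) (g y)) =
    (mulmxr (row_mx 1%:M 0) \o f) + (mulmxr (row_mx 0 1%:M) \o g).
  apply/funext => y; rewrite !fctE /= !mul_mx_row !mulmx1 !mulmx0.
  by rewrite add_row_mx addr0 add0r.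
by apply: differentiableD; apply: differentiable_comp => //;
  apply: linear_differentiable; exact: mulmxr_continuous.
Qed.

End RowVectors.

(** In charts, freezing one argument is precomposition of a smooth function on
    the product chart with an affine embedding. *)
Lemma smooth_pair_differentiable {R : realType} {M : manifold R}
    (f : M -> M -> R) (x y : M) : smooth_pair f ->
  differentiable ((f ^~ y) \o cinv (chart_at x) : _ -> R^o) (cfun (chart_at x) x) /\
  differentiable (f x \o cinv (chart_at y) : _ -> R^o) (cfun (chart_at y) y).
Proof.
pose c := chart_at x; pose c' := chart_at y => sf.
have cx : cdom c x := chart_at_dom x; have cy : cdom c' y := chart_at_dom y.
pose F (w : 'rV[R]_(mdim M + mdim M)) : R^o :=
  f (cinv c (lsubmx w)) (cinv c' (rsubmx w)).
have [dF _] := sf c c' (chart_at_atlas x) (chart_at_atlas y) 1%N.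
have {}dF : differentiable F (row_mx (cfun c x) (cfun c' y)).
  by apply: dF; rewrite /= row_mxKl row_mxKr; split; exact: cfun_cod.
split.
  have -> : (f ^~ y) \o cinv c = F \o (fun u => row_mx u (cfun c' y)).
    by apply/funext => u; rewrite /F /= row_mxKl row_mxKr cfunK.
  by apply: differentiable_comp; [exact: differentiable_row_mx | exact: dF].
have -> : f x \o cinv c' = F \o (fun u => row_mx (cfun c x) u).
  by apply/funext => u; rewrite /F /= row_mxKl row_mxKr cfunK.
by apply: differentiable_comp; [exact: differentiable_row_mx | exact: dF].
Qed.

(** * Components on the factors of a product *)

Section Factors.
Context {R : realType} {n : nat} {Q : 'I_n -> manifold R}.
Local Notation QQ := (prod_manifold Q).
Local Notation d := (fun i => mdim (Q i)).

(** The preferred chart at [q] is the product of the preferred charts at the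
    [q i], so in these charts the projection is, near the image of [q], the
    linear block projection, which is its own derivative. *)
Lemma tangent_map_mproj (i : 'I_n) (q : QQ) (v : tangent q) :
  tangent_map (mproj i) q v = block_out i v.
Proof.
pose c : chart R QQ (mdim QQ) := chart_at q.
have E : \forall y \near cfun c q, block_out i y =
    (cfun (chart_at (q i)) \o mproj i \o cinv c) y.
  near=> y; have yc : ccod c y.
    by near: y; apply: open_nbhs_nbhs; split;
      [exact: ccod_open | apply: cfun_cod; exact: chart_at_dom].
  by rewrite /= /mproj [RHS](cinvK (yc i)).
have cb := @block_out_continuous R n d i.
have [_] := near_eq_diff E (linear_differentiable _ cb).
by rewrite lfunE /= => ->; rewrite (diff_lin _ cb).
Unshelve. all: by end_near. Qed.

Lemma horizontalE (q : QQ) i v : horizontal q i v = block_in v.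
Proof. by rewrite lfunE. Qed.

(** Every tangent vector is the sum of the horizontal lifts of its blocks. *)
Lemma cotangent_ext (q : QQ) (p p' : cotangent q) :
  (forall i, component p i = component p' i) -> p = p'.
Proof.
move=> pp'; apply/lfunP => v.
rewrite -[v]submxrowK (mxrow_block_in (fun i => submxrow v i)) !linear_sum.
apply: eq_bigr => i _.
have /lfunP/(_ (submxrow v i)) := pp' i.
by rewrite !lfunE /= !horizontalE.
Qed.

Lemma componentD (q : QQ) (p p' : cotangent q) i :
  component (p + p') i = component p i + component p' i.
Proof. exact: comp_lfunDl. Qed.

Lemma componentN (q : QQ) (p : cotangent q) i :
  component (- p) i = - component p i.
Proof. exact: comp_lfunNl. Qed.

Lemma componentZ (q : QQ) (k : R) (p : cotangent q) i :
  component (k *: p) i = k *: component p i.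
Proof. exact/esym/comp_lfunZl. Qed.

Lemma component_sum (q : QQ) (I : finType) (p : I -> cotangent q) i :
  component (\sum_a p a) i = \sum_a component (p a) i.
Proof.
apply: (big_morph (fun p : cotangent q => component p i)).
  by move=> x y; exact: componentD.
exact: comp_lfun0l.
Qed.

Lemma component_pullback_id i (w : oneform (Q i)) (q : QQ) :
  component (pullback (mproj i) w q) i = w (q i).
Proof.
apply/lfunP => v; rewrite !comp_lfunE horizontalE tangent_map_mproj.
by rewrite block_out_in dfwithin.
Qed.

Lemma component_pullback_neq i j (w : oneform (Q i)) (q : QQ) : i != j ->
  component (pullback (mproj i) w q) j = 0.
Proof.
move=> ij; apply/lfunP => v; rewrite !comp_lfunE horizontalE tangent_map_mproj.
by rewrite block_out_in dfwithout 1?eq_sym // linear0 lfunE.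
Qed.

Lemma mem_interconnected (D : forall i, tangent_distribution (Q i))
    (S : tangent_distribution QQ) (q : QQ) (v : tangent q) :
  v \in interconnected_distribution D S q <->
  (forall i, block_out i v \in D i (q i)) /\ v \in S q.
Proof.
rewrite /interconnected_distribution memv_cap; split.
  move=> /andP[+ vS]; rewrite memvE => /subv_bigcapP vD; split=> // i.
  by have := vD i isT; rewrite -memvE -memv_preim tangent_map_mproj.
move=> [vD vS]; rewrite vS andbT memvE; apply/subv_bigcapP => i _.
by rewrite -memvE -memv_preim tangent_map_mproj; exact: vD.
Qed.

(** In the product chart the [j]-th summand is its coordinate expression
    composed with the [j]-th block projection; its derivative along a vector of
    the [i]-th block is therefore zero unless [j] = [i]. *)
Lemma component_mdiff_sum (f : forall i, Q i -> R) (q : QQ) i :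
  (forall j, differentiable (f j \o cinv (chart_at (q j)) : _ -> R^o)
               (cfun (chart_at (q j)) (q j))) ->
  component (mdiff (fun x : QQ => \sum_j f j (x j)) q) i = mdiff (f i) (q i).
Proof.
move=> df; apply/lfunP => v; rewrite lfunE /= horizontalE !lfunE /=.
pose g j : 'rV[R]_(mdim (Q j)) -> R^o := f j \o cinv (chart_at (q j)).
set x := pc_fun _ _.
have xE j : block_out j x = cfun (chart_at (q j)) (q j).
  by rewrite block_outE mxrowK.
have -> : (fun x : QQ => \sum_j f j (x j)) \o pc_inv (fun j => chart_at (q j))
    = \sum_j (g j \o @block_out R n d j).
  by apply/funext => y; rewrite fct_sumE; exact: eq_bigr.
have cb j := @block_out_continuous R n d j.
have dgb j : is_diff x (g j \o @block_out R n d j)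
    ('d (g j) (cfun (chart_at (q j)) (q j)) \o @block_out R n d j).
  apply: DiffDef; last first.
    rewrite diff_comp ?xE ?(diff_lin _ (cb j)) //.
    exact: (linear_differentiable _ (cb j)).
  by apply: differentiable_comp; [exact: (linear_differentiable _ (cb j)) | rewrite xE].
have -> : 'd (\sum_j (g j \o @block_out R n d j)) x =
   \sum_j ('d (g j) (cfun (chart_at (q j)) (q j)) \o @block_out R n d j) :> (_ -> _).
  by have ds := is_diff_sum dgb; rewrite diff_val.
rewrite fct_sumE [LHS](bigD1 i) //= block_out_in dfwithin big1 ?addr0 // => j ji.
by rewrite block_out_in dfwithout 1?eq_sym // linear0.
Qed.

End Factors.

(** * The two systems of equations *)

Section Dirac.
Context {R : realType} {n : nat} {Q : 'I_n -> manifold R}.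
Local Notation QQ := (prod_manifold Q).

Lemma component_D1_sum (Ld : forall i, Q i -> Q i -> R) (q q' : QQ) i :
  (forall j, smooth_pair (Ld j)) ->
  component (D1 (fun x y : QQ => \sum_j Ld j (x j) (y j)) q q') i =
  D1 (Ld i) (q i) (q' i).
Proof.
move=> sL; apply: (@component_mdiff_sum _ _ _ (fun j => (Ld j)^~ (q' j))) => j.
by have [] := smooth_pair_differentiable (q j) (q' j) (sL j).
Qed.

Lemma component_D2_sum (Ld : forall i, Q i -> Q i -> R) (q q' : QQ) i :
  (forall j, smooth_pair (Ld j)) ->
  component (D2 (fun x y : QQ => \sum_j Ld j (x j) (y j)) q q') i =
  D2 (Ld i) (q i) (q' i).
Proof.
move=> sL; apply: (@component_mdiff_sum _ _ _ (fun j => Ld j (q j))) => j.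
by have [] := smooth_pair_differentiable (q j) (q' j) (sL j).
Qed.

(** A vector lies in the interconnected distribution when its blocks are killed
    by all [w i a] and the vector itself by all [alpha b]; the first condition
    says that the lifted forms vanish on it. *)
Lemma interconnected_spans (m : 'I_n -> nat) (l : nat)
    (w : forall i, 'I_(m i) -> oneform (Q i)) (alpha : 'I_l -> oneform QQ)
    (D : forall i, tangent_distribution (Q i)) (S : tangent_distribution QQ) :
  (forall i, spans_annihilator (w i) (D i)) -> spans_annihilator alpha S ->
  spans_annihilator (constraint_forms w alpha) (interconnected_distribution D S).
Proof.
move=> /(_ _)/spans_annihilatorP wD /spans_annihilatorP aS.
have pE i a (q : QQ) (v : tangent q) :
    pullback (mproj i) (w i a) q v = w i a (q i) (block_out i v).
  by rewrite comp_lfunE tangent_map_mproj.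
apply/spans_annihilatorP => q v; rewrite mem_interconnected; split.
  move=> [vD vS] [[i a]|b] /=; last exact: (aS q v).1.
  by rewrite pE; exact: ((wD i (q i) _).1 (vD i)).
move=> bv; split=> [i|]; last by apply/aS => b; exact: bv (inr b).
by apply/wD => a; rewrite -pE; exact: bv (inl (Tagged (fun i => 'I_(m i)) a)).
Qed.

Definition join_multipliers (m : 'I_n -> nat) (l : nat)
    (mu : forall i, 'I_(m i) -> R) (lambda : 'I_l -> R)
    (c : constraint_index m l) : R :=
  match c with
  | inl ia => mu (tag ia) (tagged ia)
  | inr b => lambda b
  end.

(** Lifts of one-forms from the other factors contribute nothing to the [i]-th
    component, so of the double sum over factors and forms only the [i]-th row
    remains. *)
Lemma component_constraint_sum (m : 'I_n -> nat) (l : nat)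
    (w : forall i, 'I_(m i) -> oneform (Q i)) (alpha : 'I_l -> oneform QQ)
    (mu : forall i, 'I_(m i) -> R) (lambda : 'I_l -> R) (q : QQ) i :
  component (\sum_c join_multipliers mu lambda c *: constraint_forms w alpha c q) i
  = \sum_a mu i a *: w i a (q i) + \sum_b lambda b *: component (alpha b q) i.
Proof.
rewrite big_sumType componentD !component_sum; congr (_ + _); last first.
  by apply: eq_bigr => b _; rewrite componentZ.
rewrite -(@sig_big_dep _ _ _ _ _ xpredT (fun _ => xpredT)
  (fun j a => component (mu j a *: pullback (mproj j) (w j a) q) i)) /=.
rewrite (bigD1 i) //= [X in _ + X]big1 ?addr0 => [|j ji].
  by apply: eq_bigr => a _; rewrite componentZ component_pullback_id.
by apply: big1 => a _; rewrite componentZ component_pullback_neq // scaler0.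
Qed.

(** The two systems agree for each fixed choice of multipliers, by comparing
    the components of the covector equations. *)
Lemma interconnected_dirac (K : set nat) (Ld : forall i, Q i -> Q i -> R)
    (m : 'I_n -> nat) (w : forall i, 'I_(m i) -> oneform (Q i))
    (wd : forall i, 'I_(m i) -> Q i -> Q i -> R)
    (wtd : forall i, 'I_(m i) -> QQ -> QQ -> R)
    (l : nat) (alpha : 'I_l -> oneform QQ) (alphad : 'I_l -> QQ -> QQ -> R)
    (q : nat -> QQ) (p : forall k, cotangent (q k))
    (mu : nat -> forall i, 'I_(m i) -> R) (lambda : nat -> 'I_l -> R) :
  (forall i, smooth_pair (Ld i)) -> compatible_discretization wd wtd ->
  interconnected_equations K Ld w wd alpha alphad p mu lambda <->
  discrete_dirac_equations K (fun x y : QQ => \sum_i Ld i (x i) (y i))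
    (constraint_forms w alpha) (constraint_functions wtd alphad) p
    (fun k => join_multipliers (mu k) (lambda k)).
Proof.
move=> sL comp; split=> H k Kk.
  have [Hi Hb] := H k Kk; split=> [||[[i a]|b]] /=; last exact: Hb.
  - apply: cotangent_ext => i; have [-> _ _] := Hi i.
    by rewrite component_D2_sum.
  - apply: cotangent_ext => i; have [_ -> _] := Hi i.
    by rewrite componentD componentN component_D1_sum // component_constraint_sum addrA.
  - by rewrite comp; have [_ _] := Hi i; exact.
have [H1 H2 H3] := H k Kk; split=> [i|b]; last exact: H3 (inr b).
split=> [||a].
- by rewrite H1 component_D2_sum.
- by rewrite H2 componentD componentN component_D1_sum // component_constraint_sum addrA.
- by rewrite -comp; exact: H3 (inl (Tagged (fun i => 'I_(m i)) a)).
Qed.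

End Dirac.

Theorem theorem2 (R : realType) (n : nat) (Q : 'I_n -> manifold R)
  (L : forall i, lagrangian (Q i)) (L_smooth : forall i, smooth_lagrangian (L i))
  (Delta : forall i, tangent_distribution (Q i)) (Sigma : tangent_distribution (prod_manifold Q))
  (phi : forall i, lagrangian_discretization (Q i))
  (phiQ : lagrangian_discretization (prod_manifold Q))
  (phi_linear : linear_discretization phi phiQ)
  (m : 'I_n -> nat) (w : forall i, 'I_(m i) -> oneform (Q i))
  (w_smooth : forall i a, smooth_oneform (w i a))
  (w_basis : forall i, annihilator_basis (w i) (Delta i))
  (l : nat) (alpha : 'I_l -> oneform (prod_manifold Q))
  (alpha_smooth : forall b, smooth_oneform (alpha b))
  (alpha_basis : annihilator_basis alpha Sigma)
  (wd : forall i, 'I_(m i) -> Q i -> Q i -> R)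
  (wtd : forall i, 'I_(m i) -> prod_manifold Q -> prod_manifold Q -> R)
  (alphad : 'I_l -> prod_manifold Q -> prod_manifold Q -> R)
  (wd_compatible : compatible_discretization wd wtd) :
  let beta := constraint_forms w alpha in
  let betad := constraint_functions wtd alphad in
  spans_annihilator beta (interconnected_distribution Delta Sigma) /\
  forall (K : set nat) (q : nat -> prod_manifold Q) (p : forall k, cotangent (q k)),
    (exists mu lambda, interconnected_equations K (fun i => phi i (L i))
       w wd alpha alphad p mu lambda) <->
    (exists eta, discrete_dirac_equations K (phiQ (sum_lagrangian L))
       beta betad p eta).
Proof.
move=> beta betad; split.
  by apply: interconnected_spans => [i|]; [have [] := w_basis i | case: alpha_basis].
move=> K q p.
have sL i : smooth_pair (phi i (L i)) by exact: discretize_smooth.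
have -> : phiQ (sum_lagrangian L) =
    (fun x y => \sum_i phi i (L i) (x i) (y i)) :> (_ -> _ -> _).
  by apply/funext => x; apply/funext => y; exact: phi_linear.
split=> [[mu [lambda H]]|[eta H]].
  exists (fun k => join_multipliers (mu k) (lambda k)).
  exact/(interconnected_dirac _ _ _ _ _ _ _ sL wd_compatible).
exists (fun k i a => eta k (inl (Tagged (fun i => 'I_(m i)) a))).
exists (fun k b => eta k (inr b)).
apply/(interconnected_dirac _ _ _ _ _ _ _ sL wd_compatible).
(* Joining the two parts of eta gives back eta. *)
congr (discrete_dirac_equations _ _ _ _ _ _): H.
by apply/funext => k; apply/funext => -[[i a]|b].
Qed.
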